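(* Let $\mathcal X$ be a real separable Hilbert space, let $R\in\mathcal L(\mathcal X)$ be a positive and self-adjoint operator, and let $\alpha\in(0,1)$. Up to an equivalent renorming, it holds $$(\mathrm{BUC}(\mathcal X),\mathfrak X)_{\alpha,\infty}=\mathrm{BUC}^\alpha_R(\mathcal X).$$
   Context: $\mathcal X$ has inner product $\langle\cdot,\cdot\rangle$ and norm $\|\cdot\|$. $R$ positive means $\langle Rx,x\rangle>0$ for all $x\in\mathcal X\setminus\{0\}$. $H_R:=R(\mathcal X)$ is a separable Hilbert space with $\langle x,y\rangle_R:=\langle R^{-1}x,R^{-1}y\rangle$ and norm $\|x\|_R:=\|R^{-1}x\|$. $\mathrm{BUC}(\mathcal X)$ is the space of real-valued bounded uniformly continuous functions on $\mathcal X$ with the sup norm $\|\cdot\|_\infty$. $\mathrm{BUC}^\alpha_R(\mathcal X)$ is the set of $f\in\mathrm{BUC}(\mathcal X)$ with $[f]_{\mathrm{BUC}^\alpha_R(\mathcal X)}:=\sup_{x\in\mathcal X,\,h\in H_R\setminus\{0\}}|f(x+h)-f(x)|/\|h\|_R^\alpha<+\infty$, with norm $\|f\|_\infty+[f]_{\mathrm{BUC}^\alpha_R(\mathcal X)}$. $\Phi:\mathcal X\to\mathbb R$ is $H_R$-differentiable at $x$ if there is $L_x\in\mathcal L(H_R;\mathbb R)$ with $\lim_{\|h\|_R\to0}|\Phi(x+h)-\Phi(x)-L_xh|/\|h\|_R=0$; $\mathcal D_R\Phi(x):=L_x$. $\mathfrak X$ is the set of $H_R$-differentiable $\varphi\in\mathrm{BUC}(\mathcal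 X)$ with $\|\mathcal D_R\varphi\|_\infty:=\sup_{x\in\mathcal X}\|\mathcal D_R\varphi(x)\|_{\mathcal L(H_R;\mathbb R)}<+\infty$, with norm $\|\varphi\|_{\mathfrak X}:=\|\varphi\|_\infty+\|\mathcal D_R\varphi\|_\infty$ (a Banach space). For Banach spaces $\mathcal K_2\subseteq\mathcal K_1$ (continuous embedding), $r>0$ and $x\in\mathcal K_1+\mathcal K_2$, $K(r,x):=\inf\{\|a\|_{\mathcal K_1}+r\|b\|_{\mathcal K_2}: x=a+b,\ a\in\mathcal K_1,\ b\in\mathcal K_2\}$; for $\vartheta\in(0,1)$, $(\mathcal K_1,\mathcal K_2)_{\vartheta,\infty}$ is the Banach space of $x\in\mathcal K_1+\mathcal K_2$ with $\|x\|_{(\mathcal K_1,\mathcal K_2)_{\vartheta,\infty}}:=\sup_{r>0}r^{-\vartheta}K(r,x)<+\infty$. *)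

(* Defs.v *)
From HB Require Import structures.
From mathcomp Require Import all_boot all_order all_algebra.
From mathcomp Require Import sesquilinear.
From mathcomp Require Import all_classical all_reals all_analysis.

Set Implicit Arguments.
Unset Strict Implicit.
Unset Printing Implicit Defensive.

Import Order.TTheory GRing.Theory Num.Theory.
Import numFieldNormedType.Exports.

Local Open Scope classical_set_scope.
Local Open Scope ring_scope.

HB.mixin Record CompleteNormedModule_isHilbert (K : realType) (X : Type)
    of CompleteNormedModule K X := {
  inner : {dot X for @idfun K} ;
  norm_inner : forall x : X, `|x| ^+ 2 = inner x x
}.

#[short(type="hilbertType")]
HB.structure Definition Hilbert (K : realType) :=
  {X of CompleteNormedModule K X & CompleteNormedModule_isHilbert K X}.

Definition separable (T : topologicalType) :=
  exists2 D : set T, countable D & dense D.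

Section operators.
Context {K : realType} {X : hilbertType K}.

Definition positive_op (R : X -> X) := forall x, x != 0 -> 0 < inner (R x) x.

Definition self_adjoint (R : X -> X) :=
  forall x y, inner (R x) y = inner x (R y).

Definition op_range (R : X -> X) : {pred X} := [in range R].

End operators.

(* This is H_R = R(X) normed by |R^-1 h|. It takes the proof that R is positive
   because R is then injective, so that |R^-1 h| is a norm. *)
Definition range_space {K : realType} {X : hilbertType K}
  {R : {linear X -> X}} (posR : positive_op R) : Type :=
  {h : X | h \in op_range R}.

Section range_space.
Context {K : realType} {X : hilbertType K} {R : {linear X -> X}}.
Variable posR : positive_op R.
Local Notation HR := (range_space posR).

HB.instance Definition _ := [isSub of HR for @sval _ _].
HB.instance Definition _ := [Choice of HR by <:].

Fact range_submod_closed : submod_closed (op_range R).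
Proof.
split; first by apply/mem_set; exists 0 => //; rewrite linear0.
move=> a u v /set_mem[x _ <-] /set_mem[y _ <-]; apply/mem_set.
by exists (a *: x + y) => //; rewrite linearP.
Qed.

HB.instance Definition _ :=
  @GRing.isSubmodClosed.Build K X (op_range R) range_submod_closed.
HB.instance Definition _ := [SubChoice_isSubLmodule of HR by <:].

Fact range_space_subproof (h : HR) : exists x, R x = val h.
Proof. by have /set_mem[x _ <-] := valP h; exists x. Qed.

Definition op_inv (h : HR) : X := sval (cid (range_space_subproof h)).

Lemma op_invK (h : HR) : R (op_inv h) = val h.
Proof. by rewrite /op_inv; case: cid. Qed.

Lemma positive_op_inj : injective R.
Proof.
move=> x y Rxy; apply/eqP; rewrite -subr_eq0; apply/negP => /negP.
by move=> /posR; rewrite (linearB R) Rxy subrr linear0l ltxx.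
Qed.

Lemma op_inv_linear : linear op_inv.
Proof.
by move=> a u v; apply: positive_op_inj; rewrite linearP !op_invK linearP.
Qed.

HB.instance Definition _ :=
  GRing.isLinear.Build K HR X *:%R op_inv op_inv_linear.

Fact normHR_triangle (u v : HR) :
  `|op_inv (u + v)| <= `|op_inv u| + `|op_inv v|.
Proof. by rewrite linearD ler_normD. Qed.

Fact normHRZ (a : K) (u : HR) : `|op_inv (a *: u)| = `|a| * `|op_inv u|.
Proof. by rewrite linearZ normrZ. Qed.

Fact normHR_eq0 (u : HR) : `|op_inv u| = 0 -> u = 0.
Proof.
by move=> /normr0_eq0 u0; apply/val_inj; rewrite -op_invK u0 !linear0.
Qed.

HB.instance Definition _ :=
  Lmodule_isNormed.Build K HR normHR_triangle normHRZ normHR_eq0.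

Lemma norm_range_spaceE (h : HR) : `|h| = `|op_inv h|.
Proof. by []. Qed.

End range_space.

(* Values of [nnorm] outside of [carrier] are irrelevant. *)
Record normed_subspace (K : realType) (V : lmodType K) := NormedSubspace {
  carrier : set V ;
  nnorm : V -> K
}.

Definition eq_renorming {K : realType} {V : lmodType K}
    (E F : normed_subspace V) :=
  carrier E = carrier F /\
  exists c C : K, [/\ 0 < c, 0 < C & forall x, carrier F x ->
    c * nnorm F x <= nnorm E x <= C * nnorm F x].

(* [sup] is real-valued, with value 0 on unbounded sets, so that the carriers
   below ask for [has_ubound]. It is also 0 on the empty set, which is the
   wanted Holder seminorm when H_R = {0}. *)
Section interpolation.
Context {K : realType} {V : lmodType K}.
Variables E1 E2 : normed_subspace V.

Definition sum_space : set V := [set a + b | a in carrier E1 & b in carrier E2].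

Definition K_functional (r : K) (x : V) : K :=
  inf [set nnorm E1 ab.1 + r * nnorm E2 ab.2 |
       ab in [set ab : V * V | [/\ carrier E1 ab.1, carrier E2 ab.2 & x = ab.1 + ab.2]]].

Definition K_weighted (theta : K) (x : V) : set K :=
  [set r `^ (- theta) * K_functional r x | r in [set r : K | 0 < r]].

Definition interpolation (theta : K) : normed_subspace V :=
  NormedSubspace [set x | sum_space x /\ has_ubound (K_weighted theta x)]
    (fun x => sup (K_weighted theta x)).

End interpolation.

Section BUC.
Context {K : realType} (X : hilbertType K).

Definition sup_norm {T : Type} (f : T -> K) : K := sup (range (fun x => `|f x|)).

Definition BUC : normed_subspace (X -> K) :=
  NormedSubspace [set f : X -> K | bounded_fun f /\ unif_continuous f] sup_norm.

End BUC.

Section function_spaces.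
Context {K : realType} {X : hilbertType K} {R : {linear X -> X}}.
Variable posR : positive_op R.
Local Notation HR := (range_space posR).

Definition holder_quotients (alpha : K) (f : X -> K) : set K :=
  [set `|f (xh.1 + val xh.2) - f xh.1| / `|xh.2| `^ alpha |
   xh in [set xh : X * HR | xh.2 != 0]].

Definition BUC_holder (alpha : K) : normed_subspace (X -> K) :=
  NormedSubspace
    [set f | carrier (BUC X) f /\ has_ubound (holder_quotients alpha f)]
    (fun f => sup_norm f + sup (holder_quotients alpha f)).

Definition is_HR_derivative (Phi : X -> K) (x : X) (L : {linear HR -> K^o}) :=
  continuous L /\
  (fun h : HR => `|Phi (x + val h) - Phi x - L h| / `|h|) @ 0^' --> (0 : K).

Definition HR_differentiable (Phi : X -> K) (x : X) :=
  exists L, is_HR_derivative Phi x L.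

Definition HR_derivative (Phi : X -> K) (x : X) : {linear HR -> K^o} :=
  get (is_HR_derivative Phi x).

Definition op_norm (L : HR -> K) : K :=
  sup [set `|L h| | h in [set h : HR | `|h| <= 1]].

Definition HR_derivative_norms (Phi : X -> K) : set K :=
  range (fun x => op_norm (HR_derivative Phi x)).

Definition frakX : normed_subspace (X -> K) :=
  NormedSubspace
    [set phi | [/\ carrier (BUC X) phi, forall x, HR_differentiable phi x &
                   has_ubound (HR_derivative_norms phi)]]
    (fun phi => sup_norm phi + sup (HR_derivative_norms phi)).

End function_spaces.

(* Main.v *)
From HB Require Import structures.
Require Import Defs.
From mathcomp Require Import all_boot all_order all_algebra.
From mathcomp Require Import all_classical all_reals all_analysis.
From mathcomp Require Import ring lra.

Set Implicit Arguments.
Unset Strict Implicit.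
Unset Printing Implicit Defensive.

Import Order.TTheory GRing.Theory Num.Theory.
Import numFieldNormedType.Exports.

Local Open Scope classical_set_scope.
Local Open Scope ring_scope.

(** Interpolation in one direction is the usual splitting argument. If
    [f = a + b] with [b] in [frakX], then the mean value theorem along the ray
    from [x] to [x + h] gives
    [|f (x + h) - f x| <= 2 (|a|_oo + |h|_R |b|_frakX)], so the increment is at
    most twice the K-functional at [r = |h|_R], which is [O(|h|_R ^ alpha)];
    and [|f|_oo <= K(1, f)] ([interpolation_holder]).

    Conversely, a function [f] of Holder seminorm [M] along [H_R] must be
    approximated within [M r ^ alpha] by a function of [frakX] of norm
    [O(r ^ (alpha - 1))], for [r <= 1] (for [r >= 1] the splitting [f = f + 0]
    is good enough). As [R] need not be Hilbert-Schmidt, smoothing by a Gaussian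
    measure is not available. Instead [f] is regularized by the sup-inf
    convolution of Lasry and Lions along [H_R]: with [A = M r ^ (alpha - 2)],
<<
      u x = sup_h (f (x + h) - A |h|_R^2),
      w x = inf_k (u (x + k) + 2 A |k|_R^2).
>>
    - Since [M s ^ alpha <= A s ^ 2 + M r ^ alpha] for all [s >= 0]
      ([powR_le_quadratic]), [f <= w <= u <= f + M r ^ alpha].
    - Sup and inf convolutions commute with translations, so [w] inherits the
      sup bound, the modulus of continuity and the Holder estimate of [f]
      ([lasry_lions_bounded], [lasry_lions_modulus]).
    - As [|.|_R] is a Hilbert norm, [u] plus a quadratic is convex along [H_R];
      the second convolution makes [w] semiconcave and, its parameter being
      larger than [A], keeps it semiconvex ([semiconvex_sup_conv],
      [semiconcave_sup_conv]). So [w] deviates from affine functions by a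
      multiple of [A |h|_R^2] on segments, in both directions, and this forces
      [|w (x + h) - w x - L h| <= 2 A |h|_R^2] for a linear [L]
      ([semiconvex_differentiable]).
    - On the sphere [|h|_R = r] this estimate and the Holder estimate give
      [|L h| <= 3 M r ^ alpha], so that [|L| <= 3 M r ^ (alpha - 1)]
      ([holder_approximation]).

    The renorming constants obtained are [1 / 3] and [4]. *)

(** * Almost linear functions *)

(** If [D] is homogeneous and additive up to errors quadratic in the arguments,
    then the slopes [D (t v) / t] converge at rate [O(t)] as [t] tends to [0],
    and their limit is linear and quadratically close to [D]. *)
Section almost_linear.
Context {K : realType} {V : normedModType K}.
Variables (D : V -> K) (C : K).
Hypothesis C_ge0 : 0 <= C.
Hypothesis D_scale : forall (l : K) v, 0 <= l <= 1 ->
  `|D (l *: v) - l * D v| <= C * (l * (1 - l)) * `|v| ^+ 2.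
Hypothesis D_add : forall u v,
  `|D (u + v) - (D u + D v)| <= C * (`|u| + `|v|) ^+ 2.

Let slope v t := D (t *: v) / t.

(** This is the limit of the slopes at [0+]. Written as a supremum, it needs no
    convergence argument: by [slope_dist] every [slope v s - C s |v|^2] is below
    every [slope v t + C t |v|^2]. *)
Definition linear_part (v : V) : K^o :=
  sup [set slope v t - C * t * `|v| ^+ 2 | t in [set t : K | 0 < t]].

Lemma slope_dist v (s t : K) : 0 < s -> s <= t ->
  `|slope v s - slope v t| <= C * t * `|v| ^+ 2.
Proof.
move=> s0 st; have t0 : 0 < t by exact: lt_le_trans st.
have l01 : 0 <= s / t <= 1.
  by rewrite divr_ge0 ?(ltW s0) ?(ltW t0)//= ler_pdivrMr// mul1r.
have := D_scale (t *: v) l01.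
rewrite scalerA divfK ?gt_eqF// => Dst.
have -> : slope v s - slope v t = s^-1 * (D (s *: v) - s / t * D (t *: v)).
  by rewrite /slope; field; rewrite ?gt_eqF.
rewrite normrM gtr0_norm ?invr_gt0// ler_pdivrMl//.
apply: le_trans Dst _; rewrite normrZ (gtr0_norm t0) exprMn.
have -> : C * (s / t * (1 - s / t)) * (t ^+ 2 * `|v| ^+ 2) =
   C * `|v| ^+ 2 * s * (t - s) by field; rewrite gt_eqF.
have -> : s * (C * t * `|v| ^+ 2) = C * `|v| ^+ 2 * s * t by ring.
by rewrite ler_wpM2l ?lerBlDr ?lerDl ?mulr_ge0 ?exprn_ge0 ?(ltW s0).
Qed.

Lemma linear_partP v t : 0 < t ->
  `|D (t *: v) - t * linear_part v| <= C * t ^+ 2 * `|v| ^+ 2.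
Proof.
move=> t0.
have ub s : 0 < s -> slope v s - C * s * `|v| ^+ 2 <=
    slope v t + C * t * `|v| ^+ 2.
  move=> s0.
  have Cs : 0 <= C * s * `|v| ^+ 2 by rewrite !mulr_ge0 ?exprn_ge0 ?(ltW s0).
  have Ct : 0 <= C * t * `|v| ^+ 2 by rewrite !mulr_ge0 ?exprn_ge0 ?(ltW t0).
  have [st|/ltW ts] := leP s t.
    by have := slope_dist v s0 st; rewrite ler_norml => /andP[_ ?]; lra.
  by have := slope_dist v t0 ts; rewrite ler_norml => /andP[? _]; lra.
have H : `|slope v t - linear_part v| <= C * t * `|v| ^+ 2.
  rewrite ler_norml; apply/andP; split.
    rewrite lerBrDr addrC -lerBrDr opprK; apply: ge_sup.
      by eexists; exists t.
    by move=> _ [s s0 <-]; exact: ub.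
  rewrite lerBlDr -lerBlDl; apply: ub_le_sup; last by exists t.
  by exists (slope v t + C * t * `|v| ^+ 2) => _ [s s0 <-]; exact: ub.
have -> : D (t *: v) - t * linear_part v = t * (slope v t - linear_part v).
  by rewrite /slope; field; rewrite gt_eqF.
rewrite normrM gtr0_norm//.
have -> : C * t ^+ 2 * `|v| ^+ 2 = t * (C * t * `|v| ^+ 2) by ring.
by rewrite ler_wpM2l// ltW.
Qed.

(** This reduces each algebraic law of [linear_part] to the matching approximate
    law of [D]. *)
Lemma linear_part_unique v (l M : K) :
  (forall t, 0 < t -> `|D (t *: v) - t * l| <= M * t ^+ 2) ->
  l = linear_part v.
Proof.
move=> Dl.
suff H t : 0 < t -> `|l - linear_part v| <= (M + C * `|v| ^+ 2) * t.
  apply/eqP; rewrite -subr_eq0 -normr_le0; apply/ler_addgt0Pr => e e0.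
  rewrite add0r.
  have [Mle0|M0] := leP (M + C * `|v| ^+ 2) 0.
    apply: le_trans (H _ ltr01) _; rewrite mulr1.
    exact: le_trans Mle0 (ltW e0).
  apply: le_trans (H (e / (M + C * `|v| ^+ 2)) _) _; first exact: divr_gt0.
  by rewrite mulrC divfK// gt_eqF.
move=> t0.
have tl : t * `|l - linear_part v| <= (M + C * `|v| ^+ 2) * t ^+ 2.
  rewrite -[X in X * _](gtr0_norm t0) -normrM.
  have -> : t * (l - linear_part v) =
    (D (t *: v) - t * linear_part v) - (D (t *: v) - t * l) by ring.
  rewrite (le_trans (ler_normB _ _))// mulrDl addrC lerD ?Dl//.
  by rewrite (le_trans (linear_partP v t0))// mulrAC.
by rewrite -(ler_pM2l t0) (le_trans tl)// expr2 mulrCA.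
Qed.

Lemma almost_linear0 : D 0 = 0.
Proof.
have /D_scale : 0 <= (0 : K) <= 1 by rewrite lexx ler01.
move=> /(_ 0); rewrite scale0r mul0r subr0 mul0r mulr0 mul0r.
by rewrite normr_le0 => /eqP.
Qed.

Lemma linear_partD u v : linear_part (u + v) = linear_part u + linear_part v.
Proof.
symmetry; apply: (@linear_part_unique _ _
  (C * (`|u| + `|v|) ^+ 2 + C * `|u| ^+ 2 + C * `|v| ^+ 2)) => t t0.
rewrite scalerDr.
have -> : D (t *: u + t *: v) - t * (linear_part u + linear_part v) =
  (D (t *: u + t *: v) - (D (t *: u) + D (t *: v)))
  + (D (t *: u) - t * linear_part u) + (D (t *: v) - t * linear_part v) by ring.
rewrite 2!mulrDl; apply: le_trans (ler_normD _ _) _; apply: lerD; last first.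
  by rewrite (le_trans (linear_partP v t0))// mulrAC.
apply: le_trans (ler_normD _ _) _; apply: lerD; last first.
  by rewrite (le_trans (linear_partP u t0))// mulrAC.
apply: le_trans (D_add _ _) _; rewrite !normrZ -mulrDr (gtr0_norm t0) exprMn.
by rewrite mulrCA mulrC.
Qed.

Lemma linear_part0 : linear_part 0 = 0.
Proof.
symmetry; apply: (@linear_part_unique _ _ 0) => t t0.
by rewrite scaler0 almost_linear0 mulr0 subrr normr0 mul0r.
Qed.

Lemma linear_partN v : linear_part (- v) = - linear_part v.
Proof. by apply/eqP; rewrite -addr_eq0 -linear_partD addNr linear_part0. Qed.

Lemma linear_partZ_gt0 a v : 0 < a -> linear_part (a *: v) = a * linear_part v.
Proof.
move=> a0; symmetry.
apply: (@linear_part_unique _ _ (C * a ^+ 2 * `|v| ^+ 2)) => t t0.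
rewrite scalerA mulrA; apply: le_trans (linear_partP v (mulr_gt0 t0 a0)) _.
by rewrite exprMn le_eqVlt; apply/orP; left; apply/eqP; ring.
Qed.

Lemma linear_part_linear : linear linear_part.
Proof.
move=> a u v; rewrite linear_partD; congr (_ + _).
have [a0|a0|->] := ltgtP a 0; last by rewrite !scale0r linear_part0.
  have Na : 0 < - a by rewrite oppr_gt0.
  by rewrite -[a]opprK scaleNr linear_partN linear_partZ_gt0// scaleNr.
exact: linear_partZ_gt0.
Qed.

Lemma almost_linear_approx :
  exists L : {linear V -> K^o}, forall v, `|D v - L v| <= C * `|v| ^+ 2.
Proof.
pose lin := GRing.isLinear.Build K V K^o *:%R linear_part linear_part_linear.
pose L : {linear V -> K^o} := HB.pack (linear_part : V -> K^o) lin.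
exists L => v; have := linear_partP v (ltr01 : 0 < (1 : K)).
by rewrite scale1r mul1r expr1n mulr1.
Qed.

End almost_linear.

(** * Semiconvexity along a subspace *)

Section semiconvexity.
Context {K : realType} {E : lmodType K} {H : normedModType K}.
Variable j : {linear H -> E}.

(** For a Hilbert norm this says that [h |-> f (x + j h) + A |h|^2] is convex
    for all [x]; semiconcavity is expressed as semiconvexity of [\- f]. *)
Definition semiconvex (A : K) (f : E -> K) := forall x v (l : K), 0 <= l <= 1 ->
  f (x + j (l *: v)) <=
    (1 - l) * f x + l * f (x + j v) + A * (l * (1 - l)) * `|v| ^+ 2.

Lemma semi_affine_dist (C : K) f : semiconvex C f -> semiconvex C (\- f) ->
  forall x v (l : K), 0 <= l <= 1 ->
  `|f (x + j (l *: v)) - ((1 - l) * f x + l * f (x + j v))| <=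
    C * (l * (1 - l)) * `|v| ^+ 2.
Proof.
move=> fC NfC x v l l01; have := fC x v l l01; have := NfC x v l l01.
by rewrite ler_norml /=; lra.
Qed.

(** On segments [f] is affine up to a quadratic error, by [semi_affine_dist];
    hence its increments at [x] are almost linear. *)
Lemma semiconvex_differentiable (C : K) f : 0 <= C ->
  semiconvex C f -> semiconvex C (\- f) ->
  forall x, exists L : {linear H -> K^o},
    forall v, `|f (x + j v) - f x - L v| <= C * `|v| ^+ 2.
Proof.
move=> C0 fC NfC x; have fdist := semi_affine_dist fC NfC.
apply: (@almost_linear_approx K H (fun v => f (x + j v) - f x)) => //.
- move=> l v l01; apply: le_trans (fdist x v l l01).
  by rewrite le_eqVlt; apply/orP; left; apply/eqP; congr `|_|; ring.
move=> u v.
have half01 : 0 <= (2^-1 : K) <= 1 by apply/andP; split; lra.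
(* The diagonals of the parallelogram x, x + u, x + u + v, x + v share their
   midpoint, where f is close to both averages of its endpoint values. *)
have := fdist (x + j u) (v - u) _ half01.
have := fdist x (u + v) _ half01.
have -> : x + j u + j (2^-1 *: (v - u)) = x + j (2^-1 *: (u + v)).
  rewrite -addrA -raddfD; congr (_ + j _).
  rewrite scalerBr scalerDr addrCA addrC; congr (_ + _).
  by rewrite -[X in X - _]scale1r -scalerBl; congr (_ *: _); field.
have -> : x + j u + j (v - u) = x + j v by rewrite -addrA -raddfD subrKC.
have d1 : `|v - u| ^+ 2 <= (`|u| + `|v|) ^+ 2.
  by rewrite lerXn2r ?nnegrE ?addr_ge0// (addrC `|u|) ler_normB.
have d2 : `|u + v| ^+ 2 <= (`|u| + `|v|) ^+ 2.
  by rewrite lerXn2r ?nnegrE ?addr_ge0// ler_normD.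
have := ler_wpM2l C0 d1; have := ler_wpM2l C0 d2.
rewrite !ler_norml; lra.
Qed.

End semiconvexity.

(** * Sup-convolution with a quadratic kernel *)

(** Stewart's theorem, an affine form of the parallelogram law: the norm of [H]
    comes from an inner product. *)
Definition hilbertian_norm {K : realType} (H : normedModType K) :=
  forall (l : K) (u v : H), `|(1 - l) *: u + l *: v| ^+ 2 =
    (1 - l) * `|u| ^+ 2 + l * `|v| ^+ 2 - l * (1 - l) * `|v - u| ^+ 2.

Section sup_convolution.
Context {K : realType} {E : lmodType K} {H : normedModType K}.
Variable j : {linear H -> E}.

Definition sup_conv (A : K) (f : E -> K) (x : E) : K :=
  sup (range (fun h : H => f (x + j h) - A * `|h| ^+ 2)).

Section bounded.
Variables (A N : K) (f : E -> K).
Hypotheses (A_ge0 : 0 <= A) (fN : forall x, `|f x| <= N).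

Lemma sup_conv_ub x h : f (x + j h) - A * `|h| ^+ 2 <= sup_conv A f x.
Proof.
apply: ub_le_sup; last by exists h.
exists N => _ [k _ <-]; rewrite lerBlDr.
apply: le_trans (ler_norm _) (le_trans (fN _) _).
by rewrite lerDl mulr_ge0// exprn_ge0.
Qed.

Lemma sup_conv_le x c :
  (forall h, f (x + j h) - A * `|h| ^+ 2 <= c) -> sup_conv A f x <= c.
Proof.
move=> fc; apply: ge_sup; first by eexists; exists 0.
by move=> _ [h _ <-].
Qed.

Lemma sup_conv_ge x : f x <= sup_conv A f x.
Proof.
have := sup_conv_ub x 0.
by rewrite raddf0 addr0 normr0 expr0n mulr0 subr0.
Qed.

Lemma sup_conv_bounded x : `|sup_conv A f x| <= N.
Proof.
rewrite ler_norml; apply/andP; split.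
  by apply: le_trans (sup_conv_ge x); have := fN x;
    rewrite ler_norml => /andP[].
apply: sup_conv_le => h; rewrite lerBlDr.
apply: le_trans (ler_norm _) (le_trans (fN _) _).
by rewrite lerDl mulr_ge0// exprn_ge0.
Qed.

Lemma sup_conv_approx x e : 0 < e ->
  exists h, sup_conv A f x - e < f (x + j h) - A * `|h| ^+ 2.
Proof.
move=> e0; pose S := range (fun h : H => f (x + j h) - A * `|h| ^+ 2).
have Ssup : has_sup S.
  split; first by eexists; exists 0.
  by exists (sup_conv A f x) => _ [h _ <-]; exact: sup_conv_ub.
by have [_ [h _ <-] ?] := sup_adherent e0 Ssup; exists h.
Qed.

(** Sup-convolution commutes with translations and does not increase uniform
    distances. *)
Lemma sup_conv_dist x y d :
  (forall h, `|f (x + j h) - f (y + j h)| <= d) ->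
  `|sup_conv A f x - sup_conv A f y| <= d.
Proof.
move=> fd; rewrite ler_norml; apply/andP; split.
  rewrite lerBrDr addrC -lerBrDr opprK; apply: sup_conv_le => h.
  by have := fd h; have := sup_conv_ub x h; rewrite ler_norml; lra.
rewrite lerBlDr; apply: sup_conv_le => h.
by have := fd h; have := sup_conv_ub y h; rewrite ler_norml; lra.
Qed.

End bounded.

Hypothesis hilbertH : hilbertian_norm H.

(** For fixed [y] in [x + H], the function [z |-> f y - A |y - z|^2] is
    [A]-semiconvex with equality, and suprema preserve semiconvexity. *)
Lemma semiconvex_sup_conv A N f : 0 <= A -> (forall x, `|f x| <= N) ->
  semiconvex j A (sup_conv A f).
Proof.
move=> A0 fN x v l /andP[l0 l1]; apply: sup_conv_le => h.
(* The point x + l v + h is reached from x by h + l v and from x + v by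
   h + l v - v, and h is the barycentre of these two shifts. *)
have /(ler_wpM2l (_ : 0 <= 1 - l)) := sup_conv_ub A0 fN x (h + l *: v).
rewrite subr_ge0 => /(_ l1).
have /(ler_wpM2l l0) := sup_conv_ub A0 fN (x + j v) (h + l *: v - v).
have -> : x + j v + j (h + l *: v - v) = x + j (l *: v) + j h.
  by rewrite -addrA -raddfD subrKC raddfD (addrC (j h)) addrA.
have -> : x + j (h + l *: v) = x + j (l *: v) + j h.
  by rewrite -addrA -raddfD (addrC h).
have := hilbertH l (h + l *: v) (h + l *: v - v).
have -> : h + l *: v - v - (h + l *: v) = - v by rewrite addrC addKr.
have -> : (1 - l) *: (h + l *: v) + l *: (h + l *: v - v) = h.
  by rewrite scalerBl scale1r scalerBr addrA subrK addrK.
rewrite normrN => /(congr1 (fun z => A * z)); lra.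
Qed.

(** Choose near-optimal shifts [h] at [x] and [k] at [x + v], and use their
    barycentre at [x + l v]. The error is
    [l (1 - l) (A |v + k - h|^2 - 2 A |k - h|^2)], and doubling the parameter is
    what makes it at most [2 A l (1 - l) |v|^2]. *)
Lemma semiconcave_sup_conv A N g : 0 <= A -> (forall x, `|g x| <= N) ->
  semiconvex j A (\- g) -> semiconvex j (2 * A) (\- sup_conv (2 * A) g).
Proof.
move=> A0 gN gA x v l /[dup] l01 /andP[l0 l1] /=; apply/ler_addgt0Pr => e e0.
have A20 : 0 <= 2 * A by rewrite mulr_ge0.
have [h hx] := sup_conv_approx A20 gN x e0.
have [k kx] := sup_conv_approx A20 gN (x + j v) e0.
have := sup_conv_ub A20 gN (x + j (l *: v)) ((1 - l) *: h + l *: k).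
have := gA (x + j h) (v + k - h) _ l01.
have -> : x + j h + j (l *: (v + k - h)) =
    x + j (l *: v) + j ((1 - l) *: h + l *: k).
  rewrite -addrA -raddfD -[RHS]addrA -raddfD; congr (_ + j _).
  rewrite scalerBr scalerDr scalerBl scale1r.
  by rewrite -addrA (addrCA h) (addrC (l *: k)) (addrA h).
have -> : x + j h + j (v + k - h) = x + j v + j k.
  by rewrite -addrA -raddfD subrKC raddfD addrA.
rewrite hilbertH /=.
have tri : `|v + k - h| ^+ 2 <= 2 * `|v| ^+ 2 + 2 * `|k - h| ^+ 2.
  apply: (@le_trans _ _ ((`|v| + `|k - h|) ^+ 2)).
    by rewrite lerXn2r ?nnegrE ?addr_ge0// -addrA ler_normD.
  by have := sqr_ge0 (`|v| - `|k - h|); lra.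
have ll : 0 <= A * (l * (1 - l)) by rewrite !mulr_ge0// subr_ge0.
have := ler_wpM2l ll tri.
have := ler_wpM2l l0 (ltW kx).
have /ler_wpM2l := ltW hx => /(_ (1 - l)); rewrite subr_ge0 => /(_ l1).
lra.
Qed.

End sup_convolution.

(** * Lasry-Lions regularization *)

Section lasry_lions.
Context {K : realType} {E : lmodType K} {H : normedModType K}.
Variables (j : {linear H -> E}) (A N : K) (f : E -> K).
Hypotheses (A_ge0 : 0 <= A) (fN : forall x, `|f x| <= N).

(** The outer inf-convolution is written as the opposite of a sup-convolution,
    so that one theory serves both. *)
Definition lasry_lions : E -> K :=
  \- sup_conv j (2 * A) (\- sup_conv j A f).

Let twoA_ge0 : 0 <= 2 * A. Proof. by rewrite mulr_ge0. Qed.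

Let uN x : `|(\- sup_conv j A f) x| <= N.
Proof. by rewrite /= normrN; exact: sup_conv_bounded. Qed.

Lemma lasry_lions_bounded x : `|lasry_lions x| <= N.
Proof. by rewrite /lasry_lions /= normrN; exact: sup_conv_bounded. Qed.

Lemma lasry_lions_ge x : f x <= lasry_lions x.
Proof.
rewrite lerNr; apply: sup_conv_le => h /=.
have := sup_conv_ub j A_ge0 fN (x + j h) (- h).
rewrite raddfN addrK normrN => fu.
rewrite mulrAC -mulrA mulr_natl mulr2n.
have : 0 <= A * `|h| ^+ 2 by rewrite mulr_ge0// exprn_ge0.
lra.
Qed.

Lemma lasry_lions_le x d :
  (forall h, f (x + j h) <= f x + (A * `|h| ^+ 2 + d)) ->
  lasry_lions x <= f x + d.
Proof.
move=> fd; rewrite lerNl; apply: le_trans (sup_conv_ge j twoA_ge0 uN x).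
by rewrite lerN2; apply: sup_conv_le => h; have := fd h; lra.
Qed.

Lemma lasry_lions_modulus z d : (forall y, `|f (y + z) - f y| <= d) ->
  forall y, `|lasry_lions (y + z) - lasry_lions y| <= d.
Proof.
move=> fz y; rewrite /lasry_lions /= -opprD normrN.
apply: (sup_conv_dist twoA_ge0 uN) => h /=.
rewrite -opprD normrN (addrAC y z); apply: (sup_conv_dist A_ge0 fN) => k.
by rewrite (addrAC _ z).
Qed.

Hypothesis hilbertH : hilbertian_norm H.

Lemma lasry_lions_differentiable x : exists L : {linear H -> K^o}, forall h,
  `|lasry_lions (x + j h) - lasry_lions x - L h| <= 2 * A * `|h| ^+ 2.
Proof.
have NK (g : E -> K) : \- (\- g) = g by apply/funext => y /=; rewrite opprK.
apply: semiconvex_differentiable => //.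
  apply: (semiconcave_sup_conv hilbertH A_ge0 uN).
  by rewrite NK; exact: (semiconvex_sup_conv j hilbertH A_ge0 fN).
by rewrite /lasry_lions NK; exact: (semiconvex_sup_conv j hilbertH twoA_ge0 uN).
Qed.

End lasry_lions.

(** * Suprema of sets of nonnegative reals *)

Section sup_facts.
Context {K : realType}.

(** The bound [0 <= c] covers the empty set, whose [sup] is [0]: there are no
    Holder quotients when [H_R] is trivial. *)
Lemma sup_le_nneg (S : set K) c : 0 <= c -> ubound S c -> sup S <= c.
Proof.
move=> c0 Sc; have [->|/set0P S0] := eqVneq S set0; first by rewrite sup0.
exact: ge_sup.
Qed.

Lemma sup_nneg (S : set K) : (forall y, S y -> 0 <= y) -> 0 <= sup S.
Proof.
move=> S0; have [[[y Sy] Sub]|/sup_out ->//] := pselect (has_sup S).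
by apply: le_trans (S0 _ Sy) _; exact: ub_le_sup.
Qed.

End sup_facts.

(** * Bounded uniformly continuous functions *)

Section BUC_facts.
Context {K : realType} {X : hilbertType K}.
Implicit Types f g : X -> K.

Lemma BUC_boundedP f : bounded_fun f <-> exists N, forall x, `|f x| <= N.
Proof.
have ? : ProperFilter (globally [set: X]).
  by apply: (@globally_properfilter _ _ 0).
split=> [/ex_bound[N fN]|[N fN]]; first by exists N => x; exact: fN.
by apply/ex_bound; exists N => x _; exact: fN.
Qed.

Lemma sup_norm_ub f x : bounded_fun f -> `|f x| <= sup_norm f.
Proof.
move=> /BUC_boundedP[N fN]; apply: ub_le_sup; last by exists x.
by exists N => _ [y _ <-].
Qed.

Lemma sup_norm_le f c : (forall x, `|f x| <= c) -> sup_norm f <= c.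
Proof.
by move=> fc; apply: ge_sup; [exists `|f 0|, 0|move=> _ [x _ <-]].
Qed.

Lemma sup_norm_ge0 f : 0 <= sup_norm f.
Proof. by apply: sup_nneg => _ [x _ <-]. Qed.

Lemma unif_continuous_modulusP f : unif_continuous f <->
  forall e, 0 < e -> exists2 d, 0 < d &
    forall z, `|z| < d -> forall x, `|f (x + z) - f x| < e.
Proof.
rewrite unif_continuousP; split => fuc e e0; have [d d0 fd] := fuc e e0.
  exists d => // z zd x; have := fd (x + z, x).
  by rewrite -!ball_normE /=; apply; rewrite addrC addKr.
exists d => // -[x y]; rewrite -!ball_normE /= => xy.
by have := fd _ xy y; rewrite subrKC.
Qed.

Lemma BUC_add f g : carrier (BUC X) f -> carrier (BUC X) g ->
  carrier (BUC X) (f + g).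
Proof.
move=> [/BUC_boundedP[N fN] /unif_continuous_modulusP fuc].
move=> [/BUC_boundedP[M gM] /unif_continuous_modulusP guc]; split.
  apply/BUC_boundedP; exists (N + M) => x; rewrite fctE.
  by rewrite (le_trans (ler_normD _ _))// lerD.
apply/unif_continuous_modulusP => e e0.
have e20 : 0 < e / 2 by rewrite divr_gt0.
have [d d0 fd] := fuc _ e20; have [d' d'0 gd] := guc _ e20.
exists (Num.min d d'); first by rewrite lt_min d0.
move=> z; rewrite lt_min => /andP[zd zd'] x; rewrite !fctE.
have := fd z zd x; have := gd z zd' x; rewrite !ltr_norml; lra.
Qed.

Lemma BUC_opp f : carrier (BUC X) f -> carrier (BUC X) (- f).
Proof.
move=> [/BUC_boundedP[N fN] /unif_continuous_modulusP fuc]; split.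
  by apply/BUC_boundedP; exists N => x; rewrite fctE normrN.
apply/unif_continuous_modulusP => e /fuc[d d0 fd]; exists d => // z zd x.
by rewrite !fctE -opprD normrN; exact: fd.
Qed.

Lemma BUC0 : carrier (BUC X) 0.
Proof.
split; first by apply/BUC_boundedP; exists 0 => x; rewrite normr0.
apply/unif_continuous_modulusP => e e0; exists 1 => // z _ x.
by rewrite subrr normr0.
Qed.

End BUC_facts.

(** * Differentiability along the range of the operator *)

Section range_space_facts.
Context {K : realType} {X : hilbertType K} {R : {linear X -> X}}.
Variable posR : positive_op R.
Local Notation HR := (range_space posR).

Lemma range_space_hilbertian : hilbertian_norm HR.
Proof.
move=> l u v.
have op_invZ t (w : HR) : op_inv (t *: w) = t *: op_inv w by rewrite linearZ.
have op_invD (w z : HR) : op_inv (w + z) = op_inv w + op_inv z.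
  by rewrite linearD.
have op_invB (w z : HR) : op_inv (w - z) = op_inv w - op_inv z.
  by rewrite linearB.
rewrite !norm_range_spaceE op_invB op_invD !op_invZ.
rewrite !norm_inner.
move: (op_inv u) (op_inv v) => {}u {}v.
have innerC (a b : X) : inner a b = inner b a :> K.
  by rewrite hermC /= expr0 mul1r.
have innerD (a b c : X) : inner (a + b) c = inner a c + inner b c :> K.
  exact: linearDl.
have innerZ t (a b : X) : inner (t *: a) b = t * inner a b :> K.
  exact: linearZl_LR.
have innerDr (a b c : X) : inner c (a + b) = inner c a + inner c b :> K.
  by rewrite innerC innerD !(innerC c).
have innerZr t (a b : X) : inner b (t *: a) = t * inner b a :> K.
  by rewrite innerC innerZ innerC.
rewrite -(scaleN1r u) !innerD !innerDr !innerZ !innerZr (innerC v u).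
ring.
Qed.

Lemma continuous_linear_bound (L : {linear HR -> K^o}) : continuous L <->
  exists2 M, 0 <= M & forall h, `|L h| <= M * `|h|.
Proof.
split=> [Lc|[M M0 LM]].
  have /linear_boundedP/pinfty_ex_gt0[M M0 LM] :=
    continuous_linear_bounded 0 (Lc 0).
  by exists M => //; exact: ltW.
apply: bounded_linear_continuous; apply/bounded_funP => r.
exists (M * r) => h hr; apply: le_trans (LM h) _.
exact: ler_wpM2l.
Qed.

Lemma op_norm_ub (L : {linear HR -> K^o}) h :
  continuous L -> `|L h| <= op_norm L * `|h|.
Proof.
move=> /continuous_linear_bound[M M0 LM].
have [->|h0] := eqVneq h 0; first by rewrite linear0 !normr0 mulr0.
have nh0 : 0 < `|h| by rewrite normr_gt0.
rewrite -ler_pdivrMr//; apply: ub_le_sup.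
  exists M => _ [k k1 <-]; apply: le_trans (LM k) _.
  by rewrite -[leRHS]mulr1 ler_wpM2l.
exists (`|h|^-1 *: h).
  by rewrite /= normrZ gtr0_norm ?invr_gt0// mulVf// gt_eqF.
by rewrite linearZ normrZ gtr0_norm ?invr_gt0// mulrC.
Qed.

Lemma op_norm_ge0 (L : HR -> K) : 0 <= op_norm L.
Proof. by apply: sup_nneg => _ [h _ <-]. Qed.

Lemma op_norm_le (L : HR -> K) c : 0 <= c ->
  (forall h, `|L h| <= c * `|h|) -> op_norm L <= c.
Proof.
move=> c0 Lc; apply: sup_le_nneg => // _ [h h1 <-].
by apply: le_trans (Lc h) _; rewrite -[leRHS]mulr1 ler_wpM2l.
Qed.

Lemma HR_derivative_ray (Phi : X -> K) x (L : {linear HR -> K^o}) h :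
  is_HR_derivative Phi x L ->
  (fun t : K => t^-1 * (Phi (x + t *: val h) - Phi x)) @ (0 : K)^' -->
  (L h : K).
Proof.
move=> [_ PhiL]; have [->|h0] := eqVneq h 0.
  rewrite (linear0 L) (_ : (fun _ => _) = cst (0 : K)); first exact: cvg_cst.
  by apply/funext => t; rewrite [val _]raddf0 scaler0 addr0 subrr mulr0.
have nh0 : 0 < `|h| by rewrite normr_gt0.
apply/cvgrPdist_lt => e e0.
have /cvgr0Pnorm_lt/(_ (e / `|h|)) := PhiL; rewrite divr_gt0// => /(_ isT).
rewrite /dnbhs near_withinE => /nbhs_norm0P[d /= d0 dPhi].
near=> t.
have t0 : t != 0 by near: t; exact: nbhs_dnbhs_neq.
have td : `|t *: h| < d.
  rewrite normrZ -ltr_pdivlMr//; near: t; apply: dnbhs0_lt.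
  exact: divr_gt0.
have := dPhi (t *: h) td; rewrite scaler_eq0 negb_or t0 h0 => /(_ isT).
have nt0 : 0 < `|t| by rewrite normr_gt0.
rewrite ger0_norm ?divr_ge0// normrZ ltr_pdivrMr ?mulr_gt0//.
have -> : e / `|h| * (`|t| * `|h|) = `|t| * e by field; rewrite gt_eqF.
have -> : L (t *: h) = t * L h :> K by rewrite linearZ.
have -> : val (t *: h) = t *: val h by rewrite [LHS]linearZ.
rewrite -(ltr_pdivrMl _ _ nt0) -normfV -normrM distrC.
by rewrite mulrBr mulKf.
Unshelve. all: by end_near. Qed.

(** Derivatives are determined by their directional values, so an estimate for
    one derivative transfers to the one selected by [HR_derivative]. *)
Lemma is_HR_derivative_unique (Phi : X -> K) x (L L' : {linear HR -> K^o}) :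
  is_HR_derivative Phi x L -> is_HR_derivative Phi x L' -> L =1 L'.
Proof.
move=> PhiL PhiL' h.
exact: cvg_unique (HR_derivative_ray PhiL) (HR_derivative_ray PhiL').
Qed.

Lemma HR_derivativeP (Phi : X -> K) x :
  HR_differentiable posR Phi x ->
  is_HR_derivative Phi x (HR_derivative posR Phi x).
Proof. exact: getPex. Qed.

Lemma HR_mean_value (Phi : X -> K) c :
  (forall x, HR_differentiable posR Phi x) ->
  (forall x, op_norm (HR_derivative posR Phi x) <= c) ->
  forall x (h : HR), `|Phi (x + val h) - Phi x| <= c * `|h|.
Proof.
move=> Phid Phic x h.
pose g (t : K) := Phi (x + t *: val h).
pose dg (t : K) := (HR_derivative posR Phi (x + t *: val h) h : K).
have g_derive (t : K) : is_derive t 1 g (dg t).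
  have dgt :
      s^-1 *: ((g \o shift t) (s *: 1) - g t) @[s --> (0 : K)^'] --> dg t.
    have := HR_derivative_ray (h := h) (HR_derivativeP (Phid (x + t *: val h))).
    apply: cvg_trans; apply: near_eq_cvg; near=> s.
    by rewrite /g /= /shift /= [s *: 1]mulr1 -addrA -scalerDl (addrC t).
  by split; [apply/cvg_ex; exists (dg t) | exact: cvg_lim dgt].
have g_cont : {within `[0, 1], continuous g}.
  by apply: derivable_within_continuous => t _; case: (g_derive t).
have [t _] := MVT_segment ler01 (fun t _ => g_derive t) g_cont.
rewrite /g scale1r scale0r addr0 subr0 mulr1 => ->.
apply: le_trans (op_norm_ub _ _) _; last exact: ler_wpM2r.
by have [] := HR_derivativeP (Phid (x + t *: val h)).
Unshelve. all: by end_near. Qed.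

(** Used with the radius [r] at which the Holder and the quadratic error terms
    balance. *)
Lemma linear_sphere_bound (L : {linear HR -> K^o}) r c : 0 < r ->
  (forall k, `|k| = r -> `|L k| <= c) -> forall h, `|L h| <= c / r * `|h|.
Proof.
move=> r0 Lc h; have [->|h0] := eqVneq h 0.
  by rewrite (linear0 L) !normr0 mulr0.
have nh0 : 0 < `|h| by rewrite normr_gt0.
have rh0 : 0 < r / `|h| by rewrite divr_gt0.
have := Lc ((r / `|h|) *: h).
have -> : L ((r / `|h|) *: h) = r / `|h| * L h :> K by rewrite linearZ.
rewrite normrZ (gtr0_norm rh0) divfK ?gt_eqF// => /(_ erefl).
rewrite normrM (gtr0_norm rh0).
by rewrite -ler_pdivlMl// invf_div mulrC mulrA mulrAC.
Qed.

Lemma quadratic_HR_derivative (Phi : X -> K) x (L : {linear HR -> K^o}) C N :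
  0 <= C -> (forall y, `|Phi y| <= N) ->
  (forall h : HR, `|Phi (x + val h) - Phi x - L h| <= C * `|h| ^+ 2) ->
  is_HR_derivative Phi x L.
Proof.
move=> C0 PhiN PhiL; split.
  have N0 : 0 <= N by exact: le_trans (PhiN 0).
  apply/continuous_linear_bound; exists ((2 * N + C) / 1).
    by rewrite divr1 addr_ge0// mulr_ge0.
  apply: linear_sphere_bound => // k k1.
  have := PhiL k; rewrite k1 expr1n mulr1.
  have := PhiN (x + val k); have := PhiN x.
  rewrite !ler_norml; lra.
apply/cvgr0Pnorm_lt => e e0.
have C10 : 0 < C + 1 by rewrite ltr_wpDl.
near=> h.
have h0 : 0 < `|h| by rewrite normr_gt0; near: h; exact: nbhs_dnbhs_neq.
rewrite ger0_norm ?divr_ge0// ltr_pdivrMr//; apply: le_lt_trans (PhiL h) _.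
rewrite expr2 mulrA ltr_pM2r//.
have : `|h| < e / (C + 1) by near: h; apply: dnbhs0_lt; exact: divr_gt0.
rewrite ltr_pdivlMr// mulrC; apply: le_lt_trans.
by rewrite ler_wpM2r// lerDl.
Unshelve. all: by end_near. Qed.

Lemma holder_quotients_ub alpha f x (h : HR) :
  has_ubound (holder_quotients posR alpha f) ->
  `|f (x + val h) - f x| <= sup (holder_quotients posR alpha f) * `|h| `^ alpha.
Proof.
move=> fub; have [->|h0] := eqVneq h 0.
  rewrite [val _]raddf0 addr0 subrr normr0 mulr_ge0 ?powR_ge0//.
  by apply: sup_nneg => _ [[y k] _ <-]; rewrite divr_ge0 ?powR_ge0.
rewrite -ler_pdivrMr ?powR_gt0 ?normr_gt0//.
by apply: ub_le_sup => //; exists (x, h).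
Qed.

(** By scaling, this is [q ^ alpha <= q ^ 2 + 1] for [q = s / r]. *)
Lemma powR_le_quadratic (alpha r s : K) : 0 <= alpha <= 2 -> 0 < r -> 0 <= s ->
  s `^ alpha <= r `^ alpha / r ^+ 2 * s ^+ 2 + r `^ alpha.
Proof.
move=> /andP[a0 a2] r0 s0; have ra0 := powR_ge0 r alpha.
have [sr|/ltW rs] := leP s r.
  apply: (@le_trans _ _ (r `^ alpha)); first by
    rewrite ge0_ler_powR ?nnegrE ?(ltW r0).
  by rewrite lerDr mulr_ge0 ?divr_ge0 ?exprn_ge0 ?(ltW r0).
rewrite -[s in leLHS](divfK (lt0r_neq0 r0)) powRM ?divr_ge0 ?(ltW r0)//.
have q1 : 1 <= s / r by rewrite ler_pdivlMr// mul1r.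
have /(ler_wpM2r ra0) := ler_powR q1 a2.
rewrite powR_mulrn ?divr_ge0 ?(ltW r0)// => /le_trans; apply.
have -> : (s / r) ^+ 2 * r `^ alpha = r `^ alpha / r ^+ 2 * s ^+ 2.
  by field; rewrite gt_eqF.
by rewrite lerDl.
Qed.

End range_space_facts.

(** * The K-functional *)

Section K_functional_facts.
Context {K : realType} {V : lmodType K} (E1 E2 : normed_subspace V).
Hypothesis nnorm1_ge0 : forall a, 0 <= nnorm E1 a.
Hypothesis nnorm2_ge0 : forall b, 0 <= nnorm E2 b.

Lemma K_functional_le r a b : 0 <= r -> carrier E1 a -> carrier E2 b ->
  K_functional E1 E2 r (a + b) <= nnorm E1 a + r * nnorm E2 b.
Proof.
move=> r0 E1a E2b; apply: ge_inf; last by exists (a, b).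
by exists 0 => _ [ab _ <-]; rewrite addr_ge0// mulr_ge0.
Qed.

Lemma K_functional_ge r x c : sum_space E1 E2 x ->
  (forall a b, carrier E1 a -> carrier E2 b -> x = a + b ->
    c <= nnorm E1 a + r * nnorm E2 b) ->
  c <= K_functional E1 E2 r x.
Proof.
move=> [a E1a [b E2b abx]] xc; apply: lb_le_inf.
  by eexists; exists (a, b).
by move=> _ [[a' b'] /= [E1a' E2b' xE] <-]; exact: xc.
Qed.

End K_functional_facts.

(** * Interpolation between BUC and the differentiable functions *)

Section interpolation_BUC_frakX.
Context {K : realType} {X : hilbertType K} {R : {linear X -> X}}.
Variable posR : positive_op R.
Local Notation HR := (range_space posR).
Local Notation frakX := (frakX posR).
Local Notation seminorm alpha f := (sup (holder_quotients posR alpha f)).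

Lemma HR_derivative_norm_ub (Phi : X -> K) x : carrier frakX Phi ->
  op_norm (HR_derivative posR Phi x) <= sup (HR_derivative_norms posR Phi).
Proof. by move=> [_ _ Phiub]; apply: ub_le_sup => //; exists x. Qed.

Lemma frakX_nnorm_ge0 Phi : 0 <= nnorm frakX Phi.
Proof.
rewrite addr_ge0 ?sup_norm_ge0//.
by apply: sup_nneg => _ [x _ <-]; exact: op_norm_ge0.
Qed.

Lemma frakX_quadratic (Phi : X -> K) c C : 0 <= c -> 0 <= C ->
  carrier (BUC X) Phi ->
  (forall x, exists2 L : {linear HR -> K^o},
    forall h : HR, `|Phi (x + val h) - Phi x - L h| <= C * `|h| ^+ 2 &
    forall h, `|L h| <= c * `|h|) ->
  carrier frakX Phi /\ sup (HR_derivative_norms posR Phi) <= c.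
Proof.
move=> c0 C0 PhiBUC PhiL.
have [N PhiN] : exists N, forall x, `|Phi x| <= N.
  by case: PhiBUC => /BUC_boundedP.
have Phi_diff x : HR_differentiable posR Phi x.
  by have [L LC _] := PhiL x; exists L; exact: quadratic_HR_derivative LC.
have Phi_norm : ubound (HR_derivative_norms posR Phi) c.
  move=> _ [x _ <-]; have [L LC Lc] := PhiL x.
  apply: op_norm_le => // h.
  have PhiLx := quadratic_HR_derivative C0 PhiN LC.
  by rewrite (is_HR_derivative_unique (HR_derivativeP (Phi_diff x)) PhiLx).
split; last exact: sup_le_nneg.
by split => //; exists c.
Qed.

Lemma frakX0 : carrier frakX 0 /\ nnorm frakX 0 = 0.
Proof.
have [||||X0 D0] := @frakX_quadratic 0 0 0.
- exact: lexx.
- exact: lexx.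
- exact: BUC0.
- move=> x; exists (\0 : {linear HR -> K^o}) => h /=.
    by rewrite !subr0 normr0 mul0r.
  by rewrite normr0 mul0r.
split => //; apply/eqP; rewrite eq_le frakX_nnorm_ge0 andbT /=.
rewrite -[leRHS]addr0 lerD//.
by apply: sup_norm_le => x; rewrite normr0.
Qed.

Lemma lasry_lions_BUC (A : K) f : 0 <= A -> carrier (BUC X) f ->
  carrier (BUC X) (lasry_lions (val : {linear HR -> X}) A f).
Proof.
move=> A0 [fb /unif_continuous_modulusP fuc].
have fN x := sup_norm_ub x fb; split.
  by apply/BUC_boundedP; exists (sup_norm f); exact: lasry_lions_bounded.
apply/unif_continuous_modulusP => e e0.
have [d d0 fd] := fuc (e / 2) (divr_gt0 e0 (ltr0n _ 2)); exists d => // z zd x.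
apply: (@le_lt_trans _ _ (e / 2)); last by lra.
by apply: (lasry_lions_modulus _ A0 fN) => y; exact/ltW/fd.
Qed.

(** The approximant is the Lasry-Lions regularization with parameter
    [M r ^ alpha / r ^ 2]. *)
Lemma holder_approximation alpha f r : 0 < alpha < 1 -> 0 < r ->
  carrier (BUC_holder posR alpha) f ->
  exists w, [/\ carrier frakX w,
    sup_norm (f - w) <= seminorm alpha f * r `^ alpha,
    sup_norm w <= sup_norm f &
    sup (HR_derivative_norms posR w) <= 3 * seminorm alpha f * r `^ alpha / r].
Proof.
move=> /andP[a0 a1] r0 [fBUC fub].
set M := seminorm alpha f; set P := r `^ alpha.
have M0 : 0 <= M.
  by apply: sup_nneg => _ [[y k] _ <-]; rewrite divr_ge0 ?powR_ge0.
have P0 : 0 <= P by exact: powR_ge0.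
pose A := M * (P / r ^+ 2).
have A0 : 0 <= A by rewrite mulr_ge0 ?divr_ge0 ?exprn_ge0 ?(ltW r0).
pose j : {linear HR -> X} := val.
have fN x : `|f x| <= sup_norm f by apply: sup_norm_ub; case: fBUC.
have f_holder x (h : HR) : `|f (x + val h) - f x| <= M * `|h| `^ alpha.
  exact: holder_quotients_ub.
pose w := lasry_lions j A f; exists w.
have w_holder x (h : HR) : `|w (x + val h) - w x| <= M * `|h| `^ alpha.
  by apply: (lasry_lions_modulus _ A0 fN) => y; exact: f_holder.
have w_le x : w x <= f x + M * P.
  apply: lasry_lions_le => // h.
  have := f_holder x h; rewrite ler_norml => /andP[_]; rewrite lerBlDl.
  move=> /le_trans; apply; rewrite lerD2l /A -mulrA -mulrDr ler_wpM2l//.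
  by apply: powR_le_quadratic => //; apply/andP; split; lra.
have w_diff x : exists2 L : {linear HR -> K^o},
    forall h : HR, `|w (x + val h) - w x - L h| <= 2 * A * `|h| ^+ 2 &
    forall h, `|L h| <= 3 * M * P / r * `|h|.
  have [L wL] := lasry_lions_differentiable j A0 fN
    (range_space_hilbertian (posR := posR)) x.
  exists L => //; apply: linear_sphere_bound => // k kr.
  (* A |k|^2 = M r ^ alpha on this sphere: the Holder increment contributes one
     such term and the quadratic remainder two. *)
  have := w_holder x k; have := wL k.
  have -> : 2 * A * `|k| ^+ 2 = 2 * (M * P).
    by rewrite kr /A; field; rewrite gt_eqF.
  rewrite kr -/P -/w !ler_norml; lra.
have [||||wX wc] := @frakX_quadratic w (3 * M * P / r) (2 * A).
- by rewrite divr_ge0 ?mulr_ge0 ?(ltW r0).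
- by rewrite mulr_ge0.
- exact: lasry_lions_BUC.
- exact: w_diff.
split => //.
  apply: sup_norm_le => x; rewrite !fctE ler_norml.
  have := w_le x; have := lasry_lions_ge j A0 fN x.
  have : 0 <= M * P by rewrite mulr_ge0.
  by rewrite -/w; lra.
by apply: sup_norm_le => x; exact: lasry_lions_bounded.
Qed.

(** For [r <= 1] the term [r |w|_oo] of the splitting [(f - w) + w] is absorbed
    by [r <= r ^ alpha]; for [r >= 1] no smoothing is needed, as
    [K(r, f) <= |f|_oo]. *)
Lemma K_functional_holder alpha f r : 0 < alpha < 1 -> 0 < r ->
  carrier (BUC_holder posR alpha) f ->
  K_functional (BUC X) frakX r f <=
    r `^ alpha * (4 * nnorm (BUC_holder posR alpha) f).
Proof.
move=> a01 r0 fF; have [fBUC fub] := fF; case/andP: (a01) => a0 a1.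
have [r1|/ltW r1] := leP r 1.
  have [w [wX fw wf wD]] := holder_approximation a01 r0 fF.
  have wBUC : carrier (BUC X) w by case: wX.
  have := K_functional_le (E1 := BUC X) (@sup_norm_ge0 _ _) frakX_nnorm_ge0
    (ltW r0) (BUC_add fBUC (BUC_opp wBUC)) wX.
  rewrite subrK => /le_trans; apply.
  have /(ler_wpM2l (ltW r0)) := wf.
  have /(ler_wpM2l (ltW r0)) := wD.
  have rE z : r * (z / r) = z by field; rewrite gt_eqF.
  rewrite rE /= => rwD rwf.
  have rP : r <= r `^ alpha.
    by rewrite -[leLHS]powRr1 ?(ltW r0)// ger_powR ?r0 ?r1// ltW.
  have := ler_wpM2r (sup_norm_ge0 f) rP.
  have := mulr_ge0 (powR_ge0 r alpha) (sup_norm_ge0 f).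
  rewrite mulrDr; lra.
have [X0 X00] := frakX0.
have := K_functional_le (E1 := BUC X) (@sup_norm_ge0 _ _) frakX_nnorm_ge0
  (ltW r0) fBUC X0.
rewrite addr0 X00 mulr0 addr0 => /le_trans; apply.
have rP : 1 <= r `^ alpha.
  by rewrite -(powRr0 r) ler_powR// ltW.
have M0 : 0 <= seminorm alpha f.
  by apply: sup_nneg => _ [[y k] _ <-]; rewrite divr_ge0 ?powR_ge0.
have f0 := sup_norm_ge0 f.
have F0 : 0 <= 4 * (sup_norm f + seminorm alpha f).
  by rewrite mulr_ge0 ?addr_ge0.
apply: (@le_trans _ _ (1 * (4 * (sup_norm f + seminorm alpha f)))).
  by rewrite /=; lra.
exact: ler_wpM2r.
Qed.

Lemma holder_interpolation alpha f : 0 < alpha < 1 ->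
  carrier (BUC_holder posR alpha) f ->
  carrier (interpolation (BUC X) frakX alpha) f /\
  nnorm (interpolation (BUC X) frakX alpha) f <=
    4 * nnorm (BUC_holder posR alpha) f.
Proof.
move=> a01 fF; have [fBUC _] := fF; have [X0 _] := frakX0.
have Kub : ubound (K_weighted (BUC X) frakX alpha f)
    (4 * nnorm (BUC_holder posR alpha) f).
  move=> _ [r /= r0 <-].
  by rewrite powRN ler_pdivrMl ?powR_gt0//; exact: K_functional_holder.
split; last by apply: ge_sup => //; eexists; exists 1; [exact: ltr01|].
split; last by exists (4 * nnorm (BUC_holder posR alpha) f).
by exists f => //; exists 0 => //; rewrite addr0.
Qed.

Lemma interpolation_holder alpha f :
  carrier (interpolation (BUC X) frakX alpha) f ->
  carrier (BUC_holder posR alpha) f /\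
  nnorm (BUC_holder posR alpha) f <=
    3 * nnorm (interpolation (BUC X) frakX alpha) f.
Proof.
set S := nnorm (interpolation (BUC X) frakX alpha) f => -[fsum fub].
have KS r : 0 < r -> K_functional (BUC X) frakX r f <= r `^ alpha * S.
  move=> r0; rewrite -ler_pdivrMl ?powR_gt0// -powRN.
  by apply: ub_le_sup => //; exists r.
have fBUC : carrier (BUC X) f.
  by case: fsum => a aBUC [b [bBUC _ _] <-]; exact: BUC_add.
have fS : sup_norm f <= S.
  have := KS 1 ltr01; rewrite powR1 mul1r; apply: le_trans.
  apply: K_functional_ge => // a b [ab _] [[bb _] _ bD] fab.
  apply: sup_norm_le => x; rewrite mul1r fab fctE.
  rewrite (le_trans (ler_normD _ _))// lerD ?sup_norm_ub//.
  rewrite (le_trans (sup_norm_ub x bb))// lerDl.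
  by apply: sup_nneg => _ [y _ <-]; exact: op_norm_ge0.
have fquot : ubound (holder_quotients posR alpha f) (2 * S).
  move=> _ [[x h] /= h0 <-]; have nh0 : 0 < `|h| by rewrite normr_gt0.
  rewrite ler_pdivrMr ?powR_gt0//.
  rewrite -mulrA [S * _]mulrC -ler_pdivrMl//.
  apply: le_trans (KS _ nh0); apply: K_functional_ge => // a b [ab _] bX fab.
  rewrite ler_pdivrMl// mulrDr fab !fctE.
  have [[bb _] bd _] := bX.
  have := HR_mean_value bd (fun y => HR_derivative_norm_ub y bX) x h.
  have := sup_norm_ub x ab; have := sup_norm_ub (x + val h) ab.
  have : 0 <= `|h| * nnorm frakX b by rewrite mulr_ge0 ?frakX_nnorm_ge0.
  have : 0 <= `|h| * sup_norm b by rewrite mulr_ge0 ?sup_norm_ge0.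
  rewrite /= !ler_norml; lra.
have S0 : 0 <= S by exact: le_trans (sup_norm_ge0 f) fS.
split; first by split => //; exists (2 * S).
have := sup_le_nneg (mulr_ge0 (ler0n K 2) S0) fquot.
rewrite /=; lra.
Qed.

End interpolation_BUC_frakX.

Theorem theorem3p3 (K : realType) (X : hilbertType K) (sepX : separable X)
    (R : {linear X -> X}) (contR : continuous R)
    (posR : positive_op R) (saR : self_adjoint R)
    (alpha : K) (alpha01 : 0 < alpha < 1) :
  eq_renorming (interpolation (BUC X) (frakX posR) alpha)
               (BUC_holder posR alpha).
Proof.
split.
  apply/seteqP; split=> f; first by move=> /interpolation_holder[].
  by move=> /(holder_interpolation alpha01)[].
exists 3^-1, 4; split=> [||f fF]; [by rewrite invr_gt0|by []|].
have [fE ->] := holder_interpolation alpha01 fF; rewrite andbT.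
by rewrite ler_pdivrMl//; have [] := interpolation_holder fE.
Qed.
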